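(* Let $G$ be a chordal graph with perfect elimination order $v_1,\ldots,v_n$, and for $0\le m\le n$ let $G_m$ be the subgraph of $G$ induced by $v_1,\ldots,v_m$. Let $S_G=\left[{G_m \brace k}\right]_{m,k=0}^n$ and $s_G=S_G^{-1}$. Then for all $m,k\in\{0,\ldots,n\}$, the $(m,k)$ entry of $s_G$ has sign $(-1)^{m-k}$ (i.e. $(-1)^{m-k}$ times it is non-negative).
   Context: A graph is chordal if it contains no induced cycle of length four or more. An ordering $v_1,\ldots,v_n$ of the vertices is a perfect elimination order if for each $m$ the neighbours of $v_m$ among $v_1,\ldots,v_{m-1}$ form a clique. For a graph $H$ and integer $k$, the graph Stirling number of the second kind ${H \brace k}$ is the number of partitions of the vertex set of $H$ into $k$ non-empty independent sets (so ${G_0\brace 0}=1$ for the empty graph $G_0$). Matrices are indexed by $\{0,\ldots,n\}$; $S_G$ is lower triangular with ones on the diagonal, hence invertible. *)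

(* Defs.v *)
From HB Require Import structures.
From mathcomp Require Import all_boot all_order all_algebra.

Set Implicit Arguments.
Unset Strict Implicit.
Unset Printing Implicit Defensive.

Import Order.TTheory GRing.Theory Num.Theory.
Local Open Scope ring_scope.

Record sgraph := SGraph {
  vertex :> finType;
  adj : rel vertex;
  adj_sym : symmetric adj;
  adj_irrefl : irreflexive adj }.

Definition induced_adj (G : sgraph) (A : {set G}) : rel {x : G | x \in A} :=
  fun x y => adj (val x) (val y).

Lemma induced_adj_sym (G : sgraph) (A : {set G}) : symmetric (@induced_adj G A).
Proof. by move=> x y; apply: adj_sym. Qed.

Lemma induced_adj_irrefl (G : sgraph) (A : {set G}) :
  irreflexive (@induced_adj G A).
Proof. by move=> x; apply: adj_irrefl. Qed.

Definition induced (G : sgraph) (A : {set G}) : sgraph :=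
  SGraph (@induced_adj_sym G A) (@induced_adj_irrefl G A).

Definition independent (G : sgraph) (A : {set G}) : bool :=
  [forall x in A, forall y in A, ~~ adj x y].

Definition clique (G : sgraph) (A : {set G}) : bool :=
  [forall x in A, forall y in A, (x != y) ==> adj x y].

(* The duplicate-free list [c], read cyclically, is an induced cycle of length
   [size c] (intended for [size c >= 3]): two of its vertices are adjacent
   exactly when they are cyclically consecutive. *)
Definition induced_cycle (G : sgraph) (c : seq G) : Prop :=
  uniq c /\
  {in c &, forall x y, adj x y = (y == next c x) || (x == next c y)}.

Definition chordal (G : sgraph) : Prop :=
  forall c : seq G, (4 <= size c)%N -> ~ induced_cycle c.

(* The vertex written v_{i+1} on paper is [v i] for [i : 'I_n], so this is the
   set {v_1, ..., v_m}. *)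
Definition initial (G : sgraph) (n : nat) (v : 'I_n -> G) (m : nat) : {set G} :=
  [set v i | i : 'I_n & (i < m)%N].

(* Bijectivity says that [v] lists every vertex exactly once; in particular
   [n = #|G|]. *)
Definition perfect_elimination_order (G : sgraph) (n : nat) (v : 'I_n -> G)
    : Prop :=
  bijective v /\
  forall m : 'I_n, clique [set x in initial v m | adj (v m) x].

Definition graph_stirling2 (H : sgraph) (k : nat) : nat :=
  #|[set P : {set {set H}} | [&& partition P [set: H],
                                 [forall A in P, independent A]
                               & #|P| == k]]|.

(* This matrix is lower unitriangular, hence in [unitmx], so that [invmx] of it
   is its actual inverse. *)
Definition stirling2_mx (G : sgraph) (n : nat) (v : 'I_n -> G)
    : 'M[rat]_n.+1 :=
  \matrix_(m < n.+1, k < n.+1)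
    (graph_stirling2 (induced (initial v m)) k)%:R.

Definition stirling1_mx (G : sgraph) (n : nat) (v : 'I_n -> G)
    : 'M[rat]_n.+1 :=
  invmx (stirling2_mx v).

(* Main.v *)
(* Let d_m be the number of neighbours of v_{m+1} among v_1, ..., v_m. They
   form a clique, so an independent partition of G_m into k blocks has exactly
   k - d_m blocks that can receive v_{m+1}; hence the Stirling numbers satisfy
   S(m+1, k) = S(m, k-1) + (k - d_m) S(m, k). The inverse matrix then satisfies
   the dual recurrence s(m+1, k) = s(m, k-1) - (m - d_k) s(m, k), and for k <= m
   we have d_k <= k <= m, which gives the signs by induction on m. *)
Require Import Defs.
From HB Require Import structures.
From mathcomp Require Import all_boot all_order all_algebra.
From mathcomp Require Import ring.

Set Implicit Arguments.
Unset Strict Implicit.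
Unset Printing Implicit Defensive.

Import Order.TTheory GRing.Theory Num.Theory.
Local Open Scope ring_scope.

(** * Partitions of a vertex set into independent blocks, and the effect of adding a vertex *)

Section IndependentPartitions.
Local Open Scope nat_scope.

Lemma leq_card_can_in (T1 T2 : finType) (D1 : {set T1}) (D2 : {set T2})
    (f : T1 -> T2) (g : T2 -> T1) :
  {in D1, forall x, f x \in D2} -> {in D1, cancel f g} -> #|D1| <= #|D2|.
Proof.
move=> fD fK; rewrite -(card_in_imset (can_in_inj fK)).
by apply/subset_leq_card/subsetP => _ /imsetP[x xD ->]; apply: fD.
Qed.

Lemma eq_card_can_in (T1 T2 : finType) (D1 : {set T1}) (D2 : {set T2})
    (f : T1 -> T2) (g : T2 -> T1) :
  {in D1, forall x, f x \in D2} -> {in D2, forall y, g y \in D1} ->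
  {in D1, cancel f g} -> {in D2, cancel g f} -> #|D1| = #|D2|.
Proof.
move=> fD gD fK gK; apply/eqP.
by rewrite eqn_leq (leq_card_can_in fD fK) (leq_card_can_in gD gK).
Qed.

Lemma disjoint_partition_notin (T : finType) (P : {set {set T}})
    (A B : {set T}) :
  partition P A -> B != set0 -> [disjoint B & A] -> B \notin P.
Proof.
move=> pP B0 dB; apply: contraNN B0 => /(partitionS pP)/setIidPl <-.
by rewrite setI_eq0.
Qed.

Variable G : sgraph.
Implicit Types (A B N : {set G}) (P Q : {set {set G}}).

Lemma independentP A :
  reflect {in A &, forall x y, ~~ adj x y} (independent A).
Proof.
apply: (iffP forall_inP) => [iA x y xA yA | iA x xA].
  by have /forall_inP := iA x xA; apply.
by apply/forall_inP => y yA; apply: iA.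
Qed.

Lemma independentS A B : A \subset B -> independent B -> independent A.
Proof.
move=> /subsetP sAB /independentP iB; apply/independentP => x y xA yA.
by apply: iB; apply: sAB.
Qed.

Lemma independent1 (x : G) : independent [set x].
Proof.
by apply/independentP => y z /set1P-> /set1P->; rewrite adj_irrefl.
Qed.

Definition nonadj (x : G) B := [forall y in B, ~~ adj x y].

Lemma independentU1 (x : G) B :
  independent (x |: B) = nonadj x B && independent B.
Proof.
apply/idP/andP => [iB | [/forall_inP nB /independentP iB]].
  split; last exact: independentS (subsetUr _ _) iB.
  apply/forall_inP => y yB.
  by apply: (independentP _ iB); rewrite ?setU11 ?setU1r.
apply/independentP => y z /setU1P[->|yB] /setU1P[->|zB].
- by rewrite adj_irrefl.
- exact: nB.
- by rewrite adj_sym nB.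
- exact: iB.
Qed.

(** The blocks are sets of vertices of [G] itself rather than of an induced subgraph, so that
    partitions for different [A] share one type and can be compared. *)
Definition indep_partitions A k : {set {set {set G}}} :=
  [set P : {set {set G}} | [&& partition P A,
     [forall B in P, independent B] & #|P| == k]].

Lemma indep_partitionsP A k P :
  reflect [/\ partition P A, {in P, forall B, independent B} & #|P| = k]
          (P \in indep_partitions A k).
Proof.
rewrite inE; apply: (iffP and3P) => [] [? H /eqP ?]; split=> //.
  exact/forall_inP.
exact/forall_inP.
Qed.

Lemma indep_partitionsU1 A B k P :
    P \in indep_partitions A k -> B != set0 -> [disjoint B & A] ->
  independent B -> B |: P \in indep_partitions (B :|: A) k.+1.
Proof.
move=> /indep_partitionsP[pP iP <-] B0 dB iB; apply/indep_partitionsP; split.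
- exact: partitionU1.
- by move=> C /setU1P[->|/iP].
- by rewrite cardsU1 (disjoint_partition_notin pP).
Qed.

Lemma indep_partitionsD1 A B k P :
    P \in indep_partitions A k.+1 -> B \in P ->
  P :\ B \in indep_partitions (A :\: B) k.
Proof.
move=> /indep_partitionsP[pP iP cP] BP; apply/indep_partitionsP; split.
- exact: partitionD1.
- by move=> C /setD1P[_ /iP].
- by move: cP; rewrite (cardsD1 B) BP => -[].
Qed.

(** Deleting the block [[set x]] is a bijection, inverted by adding it back. *)
Lemma card_indep_partitions_singleton A (x : G) k : x \notin A ->
  #|[set P in indep_partitions (x |: A) k.+1 | [set x] \in P]|
    = #|indep_partitions A k|.
Proof.
move=> xA.
have dx : [disjoint [set x] & A] by rewrite disjoints1.
apply: (eq_card_can_in (f := fun P => P :\ [set x])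
                       (g := fun P => [set x] |: P)) => [P|P PA|P|P].
- by move=> /setIdP[/indep_partitionsD1/[apply]]; rewrite setU1K.
- by rewrite inE setU11 indep_partitionsU1 ?independent1 // -cards_eq0 cards1.
- by move=> /setIdP[_ xP] /=; rewrite setD1K.
- move=> /indep_partitionsP[pP _ _] /=; rewrite setU1K //.
  by rewrite (disjoint_partition_notin pP) // -cards_eq0 cards1.
Qed.

(** Taking [x] out of its block and remembering which block it was gives a bijection onto the pairs
    of a partition of [A] and a block able to receive [x]; the sum counts these pairs. *)
Lemma card_indep_partitions_insert A (x : G) k : x \notin A ->
  #|[set P in indep_partitions (x |: A) k | [set x] \notin P]|
    = \sum_(P in indep_partitions A k) #|[set B in P | nonadj x B]|.
Proof.
move=> xA.
pose D := [set PB | [&& PB.1 \in indep_partitions A k,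
                        PB.2 \in PB.1 & nonadj x PB.2]].
have -> : \sum_(P in indep_partitions A k) #|[set B in P | nonadj x B]| = #|D|.
  rewrite -sum1_card; under eq_bigr do rewrite -sum1_card.
  by rewrite pair_big_dep; apply: eq_bigl => -[P B]; rewrite !inE.
(* For [k = 0] both sides vanish: the empty partition cannot cover [x], and it offers no block to
   choose. *)
case: k => [|k] in D *.
  have part0 (A' : {set G}) P : P \in indep_partitions A' 0 -> P = set0.
    by case/indep_partitionsP => _ _ /eqP; rewrite cards_eq0 => /eqP.
  rewrite !(eq_card0 (A := mem (pred_of_set _))) // => [[P B]|P]; apply/negbTE;
    rewrite inE; apply/negP.
    by case/and3P => /part0 /= -> /=; rewrite inE.
  case/andP => PA _; move: (part0 _ _ PA) => P0.
  move: PA; rewrite P0 => /indep_partitionsP[/cover_partition + _ _].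
  by rewrite /cover big_set0 => /setP/(_ x); rewrite !inE eqxx.
have notin_block P B : P \in indep_partitions A k.+1 -> B \in P -> x \notin B.
  by move=> /indep_partitionsP[pP _ _] /(partitionS pP)/subsetP sBA;
    apply: contra xA => /sBA.
have remain_U P B : P \in indep_partitions A k.+1 -> B \in P ->
    x |: B \notin P :\ B.
  move=> PA BP; apply/negP => /setD1P[_ /(notin_block _ _ PA)].
  by rewrite setU11.
have xblock P : P \in indep_partitions (x |: A) k.+1 ->
    (x \in pblock P x) * (pblock P x \in P).
  case/indep_partitionsP => /cover_partition cP _ _.
  by rewrite mem_pblock pblock_mem cP setU11.
(* Since [[set x]] is not a block, [B :\ x] is still non-empty; together with the vertices outside
   [B] it reassembles [A], so it can stand as a block there. *)
have remain_D P B : P \in indep_partitions (x |: A) k.+1 -> B \in P ->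
    x \in B -> [set x] \notin P ->
    [/\ B :\ x != set0, [disjoint B :\ x & (x |: A) :\: B]
      & (B :\ x) :|: ((x |: A) :\: B) = A].
  case/indep_partitionsP => pP _ _ BP xB xP; split.
  - by apply: contraNneq xP => B0; rewrite -(setU0 [set x]) -B0 setD1K.
  - rewrite -setI_eq0 -subset0; apply/subsetP => y; rewrite !inE.
    by case: (y \in B); rewrite ?andbF.
  - apply/setP => y; have := subsetP (partitionS pP BP) y; rewrite !inE.
    case: (y =P x) => [->|_] /=; first by rewrite xB (negbTE xA).
    by case: (y \in B) => //= ->.
have insert_block P B : P \in indep_partitions A k.+1 -> B \in P ->
    nonadj x B -> x |: B |: P :\ B \in indep_partitions (x |: A) k.+1.
  move=> PA BP nB; have [pP iP _] := indep_partitionsP _ _ _ PA.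
  have -> : x |: A = (x |: B) :|: (A :\: B).
    rewrite -setUA; congr (_ :|: _).
    by rewrite -{1}(setID A B) (setIidPr (partitionS pP BP)).
  apply: indep_partitionsU1; first exact: indep_partitionsD1.
  - by apply/set0Pn; exists x; rewrite setU11.
  - rewrite -setI_eq0 -subset0; apply/subsetP => y; rewrite !inE.
    case: (y =P x) => [->|_] /=; first by rewrite (negbTE xA) andbF.
    by case: (y \in B).
  - by rewrite independentU1 nB iP.
apply: (eq_card_can_in
  (f := fun P => let B := pblock P x in ((B :\ x) |: (P :\ B), B :\ x))
  (g := fun PB => (x |: PB.2) |: (PB.1 :\ PB.2))) => [P|[P B]|P|[P B]] /=.
- move=> /setIdP[PA xP]; have [xB BP] := xblock _ PA.
  have [B0 dB eA] := remain_D _ _ PA BP xB xP.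
  have [_ iP _] := indep_partitionsP _ _ _ PA.
  move: (iP _ BP); rewrite -{1}(setD1K xB) independentU1 => /andP[nB iB].
  rewrite inE /= nB setU11 andbT -{1}eA andbT.
  by apply: indep_partitionsU1 => //; apply: indep_partitionsD1.
- rewrite inE => /and3P[/= PA BP nB]; have xB := notin_block _ _ PA BP.
  have [pP _ _] := indep_partitionsP _ _ _ PA.
  rewrite inE insert_block //=.
  (* The enlarged block also contains some [y] of the non-empty [B], which avoids [x], and no other
     block contains [x]; so [[set x]] is not a block. *)
  apply/negP => /setU1P[/setP eB|/setD1P[_ /(notin_block _ _ PA)]]; last first.
    by rewrite set11.
  have /set0Pn[y yB] := partition_neq0 pP BP.
  by move: (eB y); rewrite !inE yB orbT => /eqP yx; rewrite -yx yB in xB.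
- move=> /setIdP[PA xP]; have [xB BP] := xblock _ PA.
  have [B0 dB eA] := remain_D _ _ PA BP xB xP.
  have [pP _ _] := indep_partitionsP _ _ _ PA.
  rewrite setU1K ?setD1K //.
  exact: disjoint_partition_notin (partitionD1 pP BP) B0 dB.
- rewrite inE => /and3P[/= PA BP nB]; have xB := notin_block _ _ PA BP.
  suff -> : pblock (x |: B |: P :\ B) x = x |: B.
    by rewrite !setU1K ?remain_U // setD1K.
  apply: def_pblock; rewrite ?setU11 //.
  have /indep_partitionsP[pP' _ _] := insert_block _ _ PA BP nB.
  exact: partition_trivIset pP'.
Qed.

(* The vertices of [N] form a clique, so [pblock P] maps them injectively onto
   the blocks that cannot receive [x]. *)
Lemma card_nonadj_blocks A (x : G) k P (N := [set y in A | adj x y]) :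
    clique N -> P \in indep_partitions A k ->
  #|[set B in P | nonadj x B]| + #|N| = k.
Proof.
move=> cN /indep_partitionsP[pP iP <-].
rewrite -(cardsID [set B | nonadj x B] P) setIdE; congr (_ + _).
have NA y : y \in N -> (y \in pblock P y) * (pblock P y \in P) * adj x y.
  by move=> /setIdP[yA ->]; rewrite mem_pblock pblock_mem (cover_partition pP).
rewrite -(card_in_imset (f := pblock P)) => [|y z yN zN eyz].
  apply: eq_card => B; rewrite !inE; apply/imsetP/andP => [[y yN ->]|[nB BP]].
    split; last by rewrite NA.
    by apply/negP => /forall_inP/(_ y); rewrite !NA // => /(_ isT).
  move: nB; rewrite negb_forall_in => /exists_inP[y yB]; rewrite negbK => xy.
  exists y; last by rewrite (def_pblock (partition_trivIset pP) BP yB).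
  by rewrite inE xy (subsetP (partitionS pP BP)).
apply/eqP; apply: contraT => yz.
have /forall_inP/(_ y yN)/forall_inP/(_ z zN) := cN; rewrite yz /=.
have /iP/independentP iB : pblock P y \in P by rewrite NA.
by apply: contraLR => _; apply: iB; rewrite ?NA // eyz NA.
Qed.

Lemma indep_partitions0 A : A != set0 -> indep_partitions A 0 = set0.
Proof.
move=> A0; apply/setP => P; rewrite [RHS]inE; apply/negP.
case/indep_partitionsP => pP _ /eqP; rewrite cards_eq0 => /eqP P0.
by case/eqP: A0; rewrite -(cover_partition pP) P0 /cover big_set0.
Qed.

Lemma card_indep_partitions_set0 (k : nat) :
  #|indep_partitions set0 k| = (k == 0).
Proof.
case: k => [|k].
  rewrite (_ : indep_partitions _ _ = [set set0]) ?cards1 //.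
  apply/setP => P; rewrite !inE partition_set0; case: eqP => //= ->.
  by rewrite cards0 eqxx andbT; apply/forall_inP => B; rewrite inE.
apply/eqP; rewrite cards_eq0; apply/eqP/setP => P.
rewrite !inE partition_set0; case: eqP => //= ->.
by rewrite cards0 andbF.
Qed.

End IndependentPartitions.

(** * From induced subgraphs to subsets of [G], and the recurrence for the counts *)

(** The injection [val] carries blocks of the induced subgraph to subsets of [A], preserving
    partitions, independence and the number of blocks. *)
Lemma graph_stirling2_induced (G : sgraph) (A : {set G}) k :
  graph_stirling2 (induced A) k = #|indep_partitions A k|.
Proof.
pose F (P : {set {set induced A}}) : {set {set G}} :=
  [set val @: (B : {set induced A}) | B in P].
have injV : injective (fun B : {set induced A} => val @: B : {set G}).
  exact/imset_inj/val_inj.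
have imT : val @: [set: induced A] = A :> {set G}.
  apply/setP => x; apply/imsetP/idP => [[y _ ->]|xA]; first exact: valP.
  by exists (Sub x xA).
have indF (B : {set induced A}) :
    independent (val @: B : {set G}) = independent B.
  apply/independentP/independentP => iB x y.
    by move=> xB yB; apply: iB; apply: imset_f.
  by move=> /imsetP[x' xB ->] /imsetP[y' yB ->]; apply: iB.
have FE P : (F P \in indep_partitions A k) =
    [&& partition P [set: induced A], [forall B in P, independent B]
      & #|P| == k].
  rewrite inE -{1}imT (imset_partition _ _ val_inj) (card_imset _ injV).
  congr [&& _, _ & _]; apply/forall_inP/forall_inP => iP B.
    by move=> BP; rewrite -indF iP ?imset_f.
  by move=> /imsetP[C CP ->]; rewrite indF iP.
rewrite /graph_stirling2 -(card_imset _ (imset_inj injV)).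
apply: eq_card => Q; apply/imsetP/idP => [[P + ->]|QA].
  by rewrite inE -FE.
(* Preimages give back [Q] because each of its blocks lies in [A], the image of [val]. *)
pose P := [set (val @^-1: B : {set induced A}) | B : {set G} in Q].
have FP : F P = Q.
  rewrite /F /P -imset_comp -[RHS]imset_id; apply: eq_in_imset => B BQ /=.
  have [pQ _ _] := indep_partitionsP _ _ _ QA.
  apply/setP => x; apply/imsetP/idP => [[y + ->]|xB]; first by rewrite inE.
  have xA := subsetP (partitionS pQ BQ) x xB.
  by exists (Sub x xA); rewrite ?inE.
by exists P => //; rewrite inE -FE FP.
Qed.

(** Either [x] forms a block alone, or it joins one of the [k - #|N|] blocks free of its neighbours.
    Over [rat] this factor may be negative, but when [k < #|N|] the count it multiplies is zero. *)
Lemma card_indep_partitionsU1 (G : sgraph) (A : {set G}) (x : G) k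
    (N := [set y in A | adj x y]) : x \notin A -> clique N ->
  #|indep_partitions (x |: A) k|%:R =
    (if k is k'.+1 then #|indep_partitions A k'|%:R else 0)
      + (k%:R - #|N|%:R) * #|indep_partitions A k|%:R :> rat.
Proof.
move=> xA cN; case: k => [|k].
  rewrite indep_partitions0 ?cards0; last first.
    by apply/set0Pn; exists x; rewrite setU11.
  (* Here the factor is [- #|N|]: it multiplies zero if [A] is non-empty, and it is itself zero if
     [A] is empty. *)
  have [A0|A0] := eqVneq A set0; last first.
    by rewrite indep_partitions0 ?cards0 ?mulr0 ?addr0.
  suff -> : N = set0 by rewrite cards0 subrr mul0r addr0.
  by apply/setP => y; rewrite !inE A0 inE.
pose S := [set P : {set {set G}} | [set x] \in P].
rewrite -(cardsID S) -setIdE natrD.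
rewrite card_indep_partitions_singleton //; congr (_ + _).
rewrite setDE; set X := #|_|.
have -> : X = #|[set P in indep_partitions (x |: A) k.+1 | [set x] \notin P]|.
  by apply: eq_card => P; rewrite !inE.
rewrite card_indep_partitions_insert // natr_sum.
rewrite mulr_natr -sumr_const; apply: eq_bigr => P PA.
by rewrite -{1}(card_nonadj_blocks cN PA) natrD addrK.
Qed.

(** * The inverse triangle: its signs and the inversion identity *)

(** The dual recurrence reads [d] at the column [k], while the recurrence of the second kind reads
    it at the row. For [d] identically zero these are the signed Stirling numbers of the first
    kind. *)
Fixpoint stirling1_rec (d : nat -> nat) (m k : nat) : rat :=
  if m is m'.+1 then
    (if k is k'.+1 then stirling1_rec d m' k' else 0)
      + ((d k)%:R - m'%:R) * stirling1_rec d m' k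
  else (k == 0)%:R.

Lemma stirling1_rec_small d m k : (m < k)%N -> stirling1_rec d m k = 0.
Proof.
elim: m k => [|m IHm] [|k] //= mk.
by rewrite !IHm ?mulr0 ?addr0 // ltnW.
Qed.

Lemma stirling1_rec_sign d m k : (forall i, d i <= i)%N ->
  0 <= (-1) ^+ (m + k) * stirling1_rec d m k.
Proof.
move=> dle; elim: m k => [|m IHm] k /=.
  by case: k => [|k]; rewrite ?mulr0 // mulr1.
rewrite mulrDr addr_ge0 //.
  case: k => [|k]; first by rewrite mulr0.
  by rewrite addSn addnS !exprS !mulN1r opprK.
(* The factor [d k - m] is non-positive only when [d k <= m], which [k <= m] ensures; for [m < k]
   the entry vanishes. *)
have [mk|km] := ltnP m k; first by rewrite stirling1_rec_small ?mulr0.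
rewrite addSn exprS mulN1r mulNr -mulrN -mulNr opprB mulrCA mulr_ge0 //.
by rewrite subr_ge0 ler_nat (leq_trans (dle k)).
Qed.

(** Induction on the row: once both recurrences are expanded, the terms in [d j] cancel, and what
    remains is the identity for row [m] at columns [k - 1] and [k], the latter with factor
    [k - m]. *)
Lemma stirling1_recK d (S : nat -> nat -> rat) n :
    (forall k, S 0 k = (k == 0)%:R) ->
    (forall m k, (m < n)%N -> S m.+1 k =
       (if k is k'.+1 then S m k' else 0) + (k%:R - (d m)%:R) * S m k) ->
  forall m k, (m <= n)%N ->
  \sum_(j < m.+1) stirling1_rec d m j * S j k = (m == k)%:R.
Proof.
move=> S0 SS; elim=> [|m IHm] k mn.
  by rewrite big_ord1 /= mul1r S0 eq_sym.
(* The first sum is shifted by one, its term at [j = 0] being zero; the second loses its term at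
   [j = m.+1], which lies above the diagonal. *)
have -> : \sum_(j < m.+2) stirling1_rec d m.+1 j * S j k =
    \sum_(j < m.+1) stirling1_rec d m j * S j.+1 k +
    \sum_(j < m.+1) ((d j)%:R - m%:R) * stirling1_rec d m j * S j k.
  under eq_bigr do rewrite /= mulrDl.
  rewrite big_split big_ord_recl /= mul0r add0r; congr (_ + _).
  by rewrite big_ord_recr /= stirling1_rec_small ?mulr0 ?mul0r ?addr0.
rewrite -big_split /=.
(* The added product is always zero; it gives the right side the shape of the recurrence. *)
have -> : (m.+1 == k)%:R = (if k is k'.+1 then (m == k')%:R else 0)
    + (k%:R - m%:R) * (m == k)%:R :> rat.
  have -> : (k%:R - m%:R) * (m == k)%:R = 0 :> rat.
    by case: eqP => [->|_]; rewrite ?subrr ?mul0r ?mulr0.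
  by rewrite addr0; case: k.
rewrite -(IHm k (ltnW mn)) mulr_sumr.
have -> : (if k is k'.+1 then (m == k')%:R else 0) =
   \sum_(j < m.+1) stirling1_rec d m j * (if k is k'.+1 then S j k' else 0).
  case: k => [|k]; last by rewrite IHm // ltnW.
  by rewrite big1 // => j _; rewrite mulr0.
rewrite -big_split /=; apply: eq_bigr => j _.
by rewrite (SS _ _ (leq_trans (ltn_ord j) mn)); case: k => [|k]; ring.
Qed.

(** * Application to the elimination order *)

Lemma initialS (G : sgraph) n (v : 'I_n -> G) (i : 'I_n) :
  initial v i.+1 = v i |: initial v i.
Proof.
apply/setP => x; rewrite in_setU1; apply/imsetP/orP => [[j ji ->]|].
  move: ji; rewrite inE ltnS leq_eqVlt => /orP[/eqP/val_inj->|ji].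
    by left.
  by right; apply: imset_f; rewrite inE.
case=> [/eqP->|/imsetP[j]]; first by exists i; rewrite ?inE.
by rewrite inE => ji ->; exists j; rewrite // inE ltnS ltnW.
Qed.

Theorem theorem2p1 (G : sgraph) (n : nat) (v : 'I_n -> G)
    (hG : chordal G) (hv : perfect_elimination_order v) (m k : 'I_n.+1) :
  0 <= (-1) ^ ((m : nat)%:Z - (k : nat)%:Z) * stirling1_mx v m k.
Proof.
have [/bij_inj v_inj v_clique] := hv.
pose earlier (i : 'I_n) := [set x in initial v i | adj (v i) x].
(* The default value 0 outside ['I_n] keeps [d i <= i] true for every natural number [i]. *)
pose d i := oapp (fun i' => #|earlier i'|) 0%N (insub i).
have d_le i : (d i <= i)%N.
  rewrite /d; case: insubP => //= i' _ <-; rewrite /earlier setIdE.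
  apply: leq_trans (subset_leq_card (subsetIl _ _)) _.
  rewrite (leq_trans (leq_imset_card _ _)) // cardsE -sum1_card.
  rewrite -(big_ord_widen n (fun=> 1%N) (ltnW (ltn_ord i'))).
  by rewrite sum1_card card_ord.
pose S (i j : nat) : rat := #|indep_partitions (initial v i) j|%:R.
have S0 j : S 0%N j = (j == 0%N)%:R.
  rewrite /S -(card_indep_partitions_set0 G).
  rewrite (_ : initial v 0 = set0) //; apply/eqP; rewrite -subset0.
  by apply/subsetP => x /imsetP[i]; rewrite inE.
have SS i j : (i < n)%N -> S i.+1 j =
    (if j is j'.+1 then S i j' else 0) + (j%:R - (d i)%:R) * S i j.
  move=> lt_in; rewrite /S (initialS v (Ordinal lt_in)) /d insubT /=.
  rewrite card_indep_partitionsU1 //; last exact: v_clique (Ordinal lt_in).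
  by apply/imsetP => -[i' + /v_inj e]; rewrite -e inE ltnn.
pose s := \matrix_(i < n.+1, j < n.+1) stirling1_rec d i j.
have sS : s *m stirling2_mx v = 1%:M.
  apply/matrixP => i j; rewrite !mxE.
  rewrite -[RHS](stirling1_recK S0 SS j (ltnSE (ltn_ord i))).
  (* The matrix product sums up to [n], the inversion identity only up to [i]; the extra terms lie
     above the diagonal and vanish. *)
  rewrite (big_ord_widen _ (fun l => stirling1_rec d i l * S l j) (ltn_ord i)).
  rewrite [RHS]big_mkcond; apply: eq_bigr => l _; rewrite !mxE ltnS.
  rewrite graph_stirling2_induced; case: leqP => // il.
  by rewrite stirling1_rec_small // mul0r.
(* A left inverse of a square matrix makes it invertible, and cancelling then identifies [invmx]
   with [s]. *)
have [_ S_unit] := mulmx1_unit sS.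
rewrite /stirling1_mx -[invmx _]mul1mx -sS mulmxK // mxE.
(* As -1 is its own inverse, the integer exponent [m - k] may be replaced by the natural number
   [m + k]. *)
rewrite expfzDr ?oppr_eq0 ?oner_eq0 // -exprnN invr_sign -exprnP -exprD.
exact: stirling1_rec_sign.
Qed.
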